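(* Let $A_1,A_2,A_3,A_4,B_1,B_2,B_3,B_4\subseteq\mathbf{Z}_{145}$ be the explicit subsets defined in the context. Then each of the quadruples $(A_1,A_2,A_3,A_4)$ and $(B_1,B_2,B_3,B_4)$ is a $4-(145;72,66,67,81;141)$ supplementary difference set in $\mathbf{Z}_{145}$.
   Context: $\mathbf{Z}_n$ denotes the ring (and additive group) of integers modulo $n$, and $\mathbf{Z}_n^*$ its group of invertible elements. A quadruple $(X_1,X_2,X_3,X_4)$ of subsets of $\mathbf{Z}_v$ is a $4-(v;k_1,k_2,k_3,k_4;\lambda)$ supplementary difference set (SDS, also called a difference family) if $|X_i|=k_i$ for $i=1,2,3,4$ and for every nonzero $g\in\mathbf{Z}_v$ the total number of triples $(i,x,y)$ with $i\in\{1,2,3,4\}$, $x,y\in X_i$ and $x-y=g$ equals $\lambda$. Let $n=145$ and let $H=\{1,16,36,81,111,136,141\}$, the subgroup of order $7$ of $\mathbf{Z}_{145}^*$, acting on $\mathbf{Z}_{145}$ by multiplication. Its $24$ nonzero orbits $\alpha_0,\dots,\alpha_{23}$ are enumerated as follows: $\alpha_0=H$, $\alpha_2=\{2,17,32,72,77,127,137\}$, $\alpha_4=\{3,43,48,98,108,118,133\}$, $\alpha_6=\{6,51,71,86,91,96,121\}$, $\alpha_8=\{7,52,82,107,112,117,132\}$, $\alpha_{10}=\{11,21,31,46,61,101,106\}$, $\alpha_{12}=\{14,19,69,79,89,104,119\}$, $\alpha_{14}=\{22,42,57,62,67,92,122\}$, $\alpha_{16}=\{5,35,80,100,115,120,125\}$,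 $\alpha_{18}=\{10,15,55,70,85,95,105\}$, $\alpha_{20}=\{29\}$, $\alpha_{22}=\{58\}$, and $\alpha_{2i+1}=-\alpha_{2i}$ (mod $145$) for $0\le i\le 11$. For $k=1,2,3,4$ set $A_k=\bigcup_{i\in J_k}\alpha_i$ and $B_k=\bigcup_{i\in L_k}\alpha_i$, where $J_1=\{1,2,4,7,9,10,13,14,16,19,20,22\}$, $J_2=\{0,2,4,7,10,11,14,18,19,20,21,22\}$, $J_3=\{1,3,6,9,12,13,14,17,19,20,21,22,23\}$, $J_4=\{2,3,5,6,7,9,12,13,15,16,19,20,21,22,23\}$, $L_1=\{1,3,5,7,8,10,13,15,17,18,20,23\}$, $L_2=\{0,1,2,4,12,13,15,18,19,20,22,23\}$, $L_3=\{4,5,6,7,9,12,14,16,18,20,21,22,23\}$, $L_4=\{2,6,9,10,11,12,13,14,15,17,18,20,21,22,23\}$. *)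

(* Defs.v *)
From HB Require Import structures.
From mathcomp Require Import all_boot all_order all_algebra.
Set Implicit Arguments.
Unset Strict Implicit.
Unset Printing Implicit Defensive.
Import GRing.Theory.
Local Open Scope ring_scope.

(* 4-(v; k_1, k_2, k_3, k_4; lambda) supplementary difference sets.
   Meaningful only for 1 < v, since 'Z_0 and 'Z_1 both denote Z/2. *)
Definition is_SDS4 (v k1 k2 k3 k4 lambda : nat) (X1 X2 X3 X4 : {set 'Z_v}) :
    Prop :=
  let X := [tuple X1; X2; X3; X4] in
  [/\ #|X1| = k1, #|X2| = k2, #|X3| = k3, #|X4| = k4 &
    forall g : 'Z_v, g != 0 ->
      #|[set t : 'I_4 * 'Z_v * 'Z_v |
          let: (i, x, y) := t in
          [&& x \in tnth X i, y \in tnth X i & x - y == g]]| = lambda].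

(* Residues of alpha_0, alpha_2, ..., alpha_22, in this order: the first entry
   is the subgroup H of order 7 of the units of Z_145, and together with their
   opposites these are the 24 nonzero orbits of H. *)
Definition even_orbits : seq (seq nat) :=
  [:: [:: 1; 16; 36; 81; 111; 136; 141];
      [:: 2; 17; 32; 72; 77; 127; 137];
      [:: 3; 43; 48; 98; 108; 118; 133];
      [:: 6; 51; 71; 86; 91; 96; 121];
      [:: 7; 52; 82; 107; 112; 117; 132];
      [:: 11; 21; 31; 46; 61; 101; 106];
      [:: 14; 19; 69; 79; 89; 104; 119];
      [:: 22; 42; 57; 62; 67; 92; 122];
      [:: 5; 35; 80; 100; 115; 120; 125];
      [:: 10; 15; 55; 70; 85; 95; 105];
      [:: 29];
      [:: 58]]%N.

Definition even_orbit (i : nat) : {set 'Z_145} :=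
  [set x in [seq n%:R | n <- nth [::] even_orbits i]].

Definition alpha (i : nat) : {set 'Z_145} :=
  if odd i then [set - x | x in even_orbit i./2] else even_orbit i./2.

Definition orbit_union (J : seq nat) : {set 'Z_145} :=
  \bigcup_(i <- J) alpha i.

Definition J1 : seq nat := [:: 1; 2; 4; 7; 9; 10; 13; 14; 16; 19; 20; 22]%N.
Definition J2 : seq nat := [:: 0; 2; 4; 7; 10; 11; 14; 18; 19; 20; 21; 22]%N.
Definition J3 : seq nat := [:: 1; 3; 6; 9; 12; 13; 14; 17; 19; 20; 21; 22; 23]%N.
Definition J4 : seq nat :=
  [:: 2; 3; 5; 6; 7; 9; 12; 13; 15; 16; 19; 20; 21; 22; 23]%N.
Definition L1 : seq nat := [:: 1; 3; 5; 7; 8; 10; 13; 15; 17; 18; 20; 23]%N.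
Definition L2 : seq nat := [:: 0; 1; 2; 4; 12; 13; 15; 18; 19; 20; 22; 23]%N.
Definition L3 : seq nat := [:: 4; 5; 6; 7; 9; 12; 14; 16; 18; 20; 21; 22; 23]%N.
Definition L4 : seq nat :=
  [:: 2; 6; 9; 10; 11; 12; 13; 14; 15; 17; 18; 20; 21; 22; 23]%N.

Definition A1 : {set 'Z_145} := orbit_union J1.
Definition A2 : {set 'Z_145} := orbit_union J2.
Definition A3 : {set 'Z_145} := orbit_union J3.
Definition A4 : {set 'Z_145} := orbit_union J4.
Definition B1 : {set 'Z_145} := orbit_union L1.
Definition B2 : {set 'Z_145} := orbit_union L2.
Definition B3 : {set 'Z_145} := orbit_union L3.
Definition B4 : {set 'Z_145} := orbit_union L4.

(* Main.v *)
Require Import Defs.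
From mathcomp Require Import all_boot all_order all_algebra.

(** Counting the pairs of elements of [X] with difference [g] amounts to
    counting the [y] such that both [y] and [y + g] lie in [X].  If [m] is the
    indicator word of [X], of length [v], then the indicator word of the
    translate of [X] by [- g] is [m] rotated by [g], so this number is the
    periodic autocorrelation of [m] at the shift [g] ([card_diff_pairs]).
    Being an SDS is therefore the statement that the autocorrelations of four
    binary words add up to the same constant at every nonzero shift
    ([is_SDS4_words]).  The orbits are given by explicit lists of residues, so
    that the indicator words of the eight sets are explicit too
    ([mem_orbit_union]), and the 144 sums of autocorrelations of each quadruple
    are evaluated. *)

Set Implicit Arguments.
Unset Strict Implicit.
Unset Printing Implicit Defensive.

Import GRing.Theory.
Local Open Scope ring_scope.

Definition is_indicator v (X : {set 'Z_v}) (m : bitseq) :=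
  size m = v /\ forall x : 'Z_v, (x \in X) = nth false m x.

(** Rotating the word, rather than looking up residues mod [v], keeps the
    evaluation in unary arithmetic linear in the length of the word. *)
Definition autocorrelation (m : bitseq) (g : nat) : nat :=
  count (fun p => p.1 && p.2) (zip m (rot g m)).

(** Abstracting over the list [ms] makes the evaluation compute the words once,
    and not anew for every shift. *)
Definition constant_autocorrelation_sum (v lambda : nat) (ms : seq bitseq) :=
  all (fun g => sumn [seq autocorrelation m g | m <- ms] == lambda)
    (iota 1 v.-1).

Lemma count_nth (T : Type) (x0 : T) (a : pred T) (s : seq T) :
  count a s = (\sum_(k < size s) a (nth x0 s k))%N.
Proof. by rewrite -sum1_count big_mkcond (big_nth x0) big_mkord. Qed.

Lemma nth_rot (T : Type) (x0 : T) (s : seq T) (g k : nat) :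
  (g < size s)%N -> (k < size s)%N ->
  nth x0 (rot g s) k = nth x0 s ((k + g) %% size s).
Proof.
move=> lt_g lt_k; rewrite nth_cat size_drop nth_drop addnC.
rewrite ltn_subRL addnC; case: ltnP => [lt_kg | le_kg].
  by rewrite modn_small.
have lt_kg : (k + g - size s < g)%N by rewrite ltn_subLR ?ltn_add2r.
rewrite -[in RHS](subnK le_kg) modnDr modn_small ?(ltn_trans lt_kg) //.
by rewrite subnBA 1?ltnW // nth_take.
Qed.

Lemma card_indicator v (X : {set 'Z_v}) (m : bitseq) :
  (1 < v)%N -> is_indicator X m -> #|X| = count id m.
Proof.
case: v X => [|[|n]] // X _ [size_m Xm].
rewrite (count_nth false) size_m -sum1_card big_mkcond.
by apply: eq_bigr => x _; rewrite Xm; case: nth.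
Qed.

(** A pair with difference [g] is determined by its second entry [y], and
    [y] and [y + g] are read off at the same position of [m] and [rot g m]. *)
Lemma card_diff_pairs v (X : {set 'Z_v}) (m : bitseq) (g : 'Z_v) :
    (1 < v)%N -> is_indicator X m ->
  #|[set p : 'Z_v * 'Z_v | [&& p.1 \in X, p.2 \in X & p.1 - p.2 == g]]|
    = autocorrelation m g.
Proof.
case: v X g => [|[|n]] // X g _ [size_m Xm].
have -> : [set p : 'Z_n.+2 * 'Z_n.+2 |
             [&& p.1 \in X, p.2 \in X & p.1 - p.2 == g]]
          = [set (y + g, y) | y in [set y in X | y + g \in X]].
  apply/setP => -[x y]; rewrite inE /=.
  apply/and3P/imsetP => [[Xx Xy /eqP <-] | [z]].
    by exists y; rewrite ?inE addrC subrK ?Xy.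
  by rewrite inE => /andP[Xz Xzg] [-> ->]; rewrite Xz Xzg addrAC subrr add0r.
rewrite card_imset; last by move=> y z [].
rewrite /autocorrelation (count_nth (false, false)) size_zip size_rot minnn.
rewrite size_m -sum1_card big_mkcond; apply: eq_bigr => y _.
rewrite inE nth_zip ?size_rot // nth_rot ?size_m ?ltn_ord //= !Xm.
by case: (_ && _).
Qed.

Lemma is_SDS4_words v k1 k2 k3 k4 lambda (X1 X2 X3 X4 : {set 'Z_v})
    (m1 m2 m3 m4 : bitseq) :
    (1 < v)%N ->
    is_indicator X1 m1 -> is_indicator X2 m2 ->
    is_indicator X3 m3 -> is_indicator X4 m4 ->
    [seq count id m | m <- [:: m1; m2; m3; m4]] = [:: k1; k2; k3; k4] ->
    constant_autocorrelation_sum v lambda [:: m1; m2; m3; m4] ->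
  is_SDS4 k1 k2 k3 k4 lambda X1 X2 X3 X4.
Proof.
move=> v_gt1 Xm1 Xm2 Xm3 Xm4 [<- <- <- <-] /allP sum_lambda.
split; try exact: card_indicator.
move=> g g_neq0; set X := [tuple X1; X2; X3; X4].
have /sum_lambda/eqP <- : (val g) \in iota 1 v.-1.
  rewrite mem_iota lt0n g_neq0 add1n prednK ?(ltnW v_gt1) //=.
  by rewrite -[X in (_ < X)%N](Zp_cast v_gt1) ltn_ord.
transitivity (\sum_(i < 4) #|[set p : 'Z_v * 'Z_v |
    [&& p.1 \in tnth X i, p.2 \in tnth X i & (p.1 - p.2)%R == g]]|)%N.
  under eq_bigr do rewrite -sum1_card big_mkcond.
  rewrite -sum1_card big_mkcond /= !pair_big /=.
  rewrite (reindex (fun q : 'I_4 * ('Z_v * 'Z_v) => (q.1, q.2.1, q.2.2))) /=; last first.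
    by exists (fun t => (t.1.1, (t.1.2, t.2))) => [[i [x y]] | [[i x] y]].
  by apply: eq_bigr => -[i [x y]] _; rewrite !inE.
rewrite !big_ord_recl big_ord0 /= !(tnth_nth set0) /=.
by rewrite (card_diff_pairs _ v_gt1 Xm1) (card_diff_pairs _ v_gt1 Xm2)
  (card_diff_pairs _ v_gt1 Xm3) (card_diff_pairs _ v_gt1 Xm4).
Qed.

Definition alpha_residues (i : nat) : seq nat :=
  let s := nth [::] even_orbits i./2 in
  if odd i then [seq 145 - n | n <- s]%N else s.

Definition orbit_word (J : seq nat) : bitseq :=
  let s := flatten [seq alpha_residues i | i <- J] in
  mkseq (fun k => k \in s) 145.

(** The lower bound makes [145 - n] the canonical residue of [- n]; a listed
    zero would give [145] instead. *)
Lemma even_orbits_bounds i n :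
  n \in nth [::] even_orbits i -> (0 < n < 145)%N.
Proof.
have : all (all (fun n => 0 < n < 145)%N) even_orbits by [].
have [lt_i /allP bound | ge_i _] := ltnP i (size even_orbits).
  exact: (allP (bound _ (mem_nth [::] lt_i)) n).
by rewrite nth_default.
Qed.

Lemma mem_even_orbit i (x : 'Z_145) :
  (x \in even_orbit i) = (val x \in nth [::] even_orbits i).
Proof.
rewrite inE; apply/mapP/idP => [[n si_n ->] | si_x].
  rewrite /= val_Zp_nat // modn_small //.
  by case/andP: (even_orbits_bounds si_n).
by exists (val x); rewrite //= natr_Zp.
Qed.

Lemma mem_alpha i (x : 'Z_145) : (x \in alpha i) = (val x \in alpha_residues i).
Proof.
rewrite /alpha /alpha_residues; case: (odd i); last exact: mem_even_orbit.
have val_opp (y : 'Z_145) :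
    val y \in nth [::] even_orbits i./2 -> val (- y) = (145 - val y)%N.
  case/even_orbits_bounds/andP=> y_gt0 _.
  rewrite /= modn_small // ltn_subLR ?(ltnW (ltn_ord y)) //.
  by rewrite -addn1 addnC leq_add2r.
apply/imsetP/mapP => [[y] | [n si_n x_n]].
  by rewrite mem_even_orbit => si_y ->; exists (val y); rewrite ?val_opp.
have [n_gt0 n_lt] := andP (even_orbits_bounds si_n).
have val_n : val (n%:R : 'Z_145) = n by rewrite /= val_Zp_nat // modn_small.
exists n%:R; first by rewrite mem_even_orbit val_n.
by apply: val_inj; rewrite val_opp val_n.
Qed.

Lemma mem_orbit_union J (x : 'Z_145) :
  (x \in orbit_union J) = (val x \in flatten [seq alpha_residues i | i <- J]).
Proof.
rewrite /orbit_union; elim: J => [|i J IHJ]; first by rewrite big_nil inE.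
by rewrite big_cons /= inE mem_cat IHJ mem_alpha.
Qed.

Lemma indicator_orbit_union J : is_indicator (orbit_union J) (orbit_word J).
Proof.
by split=> [|x]; rewrite ?size_mkseq // nth_mkseq ?ltn_ord ?mem_orbit_union.
Qed.

Theorem proposition3p1 :
  @is_SDS4 145 72 66 67 81 141 A1 A2 A3 A4 /\
  @is_SDS4 145 72 66 67 81 141 B1 B2 B3 B4.
Proof.
by split; apply: is_SDS4_words (indicator_orbit_union _)
  (indicator_orbit_union _) (indicator_orbit_union _)
  (indicator_orbit_union _) _ _; first exact: isT; vm_compute.
Qed.
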